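(* Let $S=\{s_1<\cdots<s_k\}$ be a $k$-subset of $\mathbf n$ and $d_S=\dim_F\langle v_S\rangle$. Then \[ d_S=\sum_{T=\{t_1<t_2<\cdots<t_l\}\subseteq S}(-1)^{|S\setminus T|}\det_{1\le i,j\le l}\binom{t_i+1}{j-i+1}. \]
   Context: $\mathbf n=\{1,\ldots,n\}$. $\mathcal{IC}_n$ is the monoid (under composition) of all injective partial maps $f$ from $D(f)\subseteq\mathbf n$ onto a subset of $\mathbf n$ that are order preserving and order decreasing ($f(a)\le a$); the empty map is included. $F$ is a field of characteristic $0$; $V$ has $F$-basis $\{v_S:S\subseteq\mathbf n\}$ with action $f\cdot v_S=v_{f(S)}$ if $S\subseteq D(f)$ and $0$ otherwise; $\langle v_S\rangle$ is the $\mathcal{IC}_n$-submodule generated by $v_S$. The sum runs over all subsets $T$ of $S$ (including $\emptyset$, for which the $0\times0$ determinant is $1$). Conventions: $\binom{a}{b}=0$ if $b<0$ or $0\le a<b$, and $\binom{a}{0}=1$. *)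

(* Defs.v *)
From HB Require Import structures.
From mathcomp Require Import all_boot all_order all_fingroup all_algebra.

Set Implicit Arguments.
Unset Strict Implicit.
Unset Printing Implicit Defensive.

Import GRing.Theory.

Local Open Scope ring_scope.

(* The set {1, ..., n} is represented by 'I_n, where the ordinal i (of value
   0, ..., n - 1) stands for the integer elt i = i + 1. *)
Definition elt n (i : 'I_n) : nat := i.+1.

(* A partial map sends a to Some b if a is in its domain, and to None if not. *)
Notation pmapping n := {ffun 'I_n -> option 'I_n}.

Section PartialMaps.

Variable n : nat.
Implicit Types (f g : pmapping n) (S T : {set 'I_n}).

Definition pdom f : {set 'I_n} := [set a | f a].

Definition pimage f S : {set 'I_n} := [set b | [exists a in S, f a == Some b]].

Definition pinjective f : bool :=
  [forall a, forall a', forall b,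
    (f a == Some b) ==> (f a' == Some b) ==> (a == a')].

Definition porder_preserving f : bool :=
  [forall a, forall a', forall b, forall b',
    (f a == Some b) ==> (f a' == Some b') ==>
      (elt a <= elt a')%N ==> (elt b <= elt b')%N].

Definition porder_decreasing f : bool :=
  [forall a, forall b, (f a == Some b) ==> (elt b <= elt a)%N].

Definition in_IC f : bool :=
  [&& pinjective f, porder_preserving f & porder_decreasing f].

Definition pcomp f g : pmapping n := [ffun a => obind f (g a)].

Definition pid : pmapping n := [ffun a => Some a].

Definition pempty : pmapping n := [ffun _ => None].

Lemma in_ICP f :
  reflect [/\ forall a a' b, f a = Some b -> f a' = Some b -> a = a',
              forall a a' b b', f a = Some b -> f a' = Some b' ->
                (a <= a')%N -> (b <= b')%N &
              forall a b, f a = Some b -> (b <= a)%N]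
          (in_IC f).
Proof.
apply: (iffP and3P) => [[/forallP fi /forallP fm /forallP fd]|[fi fm fd]].
  split=> [a a' b fa fa'|a a' b b' fa fa' le_a|a b fa].
  - by have /forallP/(_ a')/forallP/(_ b) := fi a; rewrite fa fa' !eqxx => /eqP.
  - have /forallP/(_ a')/forallP/(_ b)/forallP/(_ b') := fm a.
    by rewrite fa fa' !eqxx /= /elt !ltnS le_a.
  - by have /forallP/(_ b) := fd a; rewrite fa eqxx.
split.
- apply/forallP=> a; apply/forallP=> a'; apply/forallP=> b.
  by apply/implyP=> /eqP fa; apply/implyP=> /eqP fa'; rewrite (fi _ _ _ fa fa').
- apply/forallP=> a; apply/forallP=> a'; apply/forallP=> b; apply/forallP=> b'.
  apply/implyP=> /eqP fa; apply/implyP=> /eqP fa'; apply/implyP.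
  by rewrite /elt !ltnS; apply: fm fa fa'.
- apply/forallP=> a; apply/forallP=> b; apply/implyP=> /eqP fa.
  exact: fd fa.
Qed.

Lemma pcompE f g a b :
  pcomp f g a = Some b -> exists2 c, g a = Some c & f c = Some b.
Proof. by rewrite ffunE; case: (g a) => //= c fc; exists c. Qed.

Lemma in_IC_comp f g : in_IC f -> in_IC g -> in_IC (pcomp f g).
Proof.
move=> /in_ICP[fi fm fd] /in_ICP[gi gm gd]; apply/in_ICP; split.
- move=> a a' b /pcompE[c ga fc] /pcompE[c' ga' fc'].
  by apply: gi ga _; rewrite ga' (fi _ _ _ fc fc').
- move=> a a' b b' /pcompE[c ga fc] /pcompE[c' ga' fc'] le_a.
  exact: fm fc fc' (gm _ _ _ _ ga ga' le_a).
- move=> a b /pcompE[c ga fc]; exact: leq_trans (fd _ _ fc) (gd _ _ ga).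
Qed.

Lemma in_IC_id : in_IC pid.
Proof.
apply/in_ICP; split=> [a a' b|a a' b b'|a b]; rewrite !ffunE.
- by move=> [->] [->].
- by move=> [->] [->].
- by move=> [->].
Qed.

Lemma in_IC_empty : in_IC pempty.
Proof. by apply/in_ICP; split=> [a a' b|a a' b b'|a b]; rewrite ffunE. Qed.

Lemma pdom_comp f g S :
  (S \subset pdom (pcomp f g))
    = (S \subset pdom g) && (pimage g S \subset pdom f).
Proof.
apply/subsetP/andP=> [sS|[/subsetP sS /subsetP sI] a aS].
  split; apply/subsetP=> a.
    by move/sS; rewrite !inE ffunE; case: (g a).
  rewrite inE => /exists_inP[c cS /eqP gc].
  by have := sS c cS; rewrite !inE ffunE gc.
have := sS a aS; rewrite !inE ffunE; case ga: (g a) => [c|] //= _.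
by have := sI c; rewrite !inE; apply; apply/exists_inP; exists a; rewrite ?ga.
Qed.

Lemma pimage_comp f g S : pimage (pcomp f g) S = pimage f (pimage g S).
Proof.
apply/setP=> b; rewrite !inE; apply/exists_inP/exists_inP=> [[a aS /eqP]|[c]].
  case/pcompE=> c ga fc; exists c; last by rewrite fc.
  by rewrite inE; apply/exists_inP; exists a; rewrite ?ga.
rewrite inE => /exists_inP[a aS /eqP ga] fc.
by exists a; rewrite // ffunE ga.
Qed.

Lemma pimage_id S : pimage pid S = S.
Proof.
apply/setP=> b; rewrite inE; apply/exists_inP/idP=> [[a aS]|bS].
  by rewrite ffunE => /eqP[<-].
by exists b; rewrite // ffunE.
Qed.

Lemma pdom_id : pdom pid = setT.
Proof. by apply/setP=> a; rewrite !inE ffunE. Qed.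

End PartialMaps.

Arguments pid {n}.

Record IC (n : nat) := MkIC { IC_map :> pmapping n; _ : in_IC IC_map }.

HB.instance Definition _ n := [isSub for @IC_map n].
HB.instance Definition _ n := [Finite of IC n by <:].

Section ICMonoid.

Variable n : nat.

Definition IC_mul (f g : IC n) : IC n := MkIC (in_IC_comp (valP f) (valP g)).

Definition IC_one : IC n := MkIC (in_IC_id n).

Fact IC_mulA : associative IC_mul.
Proof.
move=> f g h; apply: val_inj; apply/ffunP=> a /=.
by rewrite !ffunE; case: (h a) => //= b; rewrite ffunE.
Qed.

Fact IC_mul1 : left_id IC_one IC_mul.
Proof.
move=> f; apply: val_inj; apply/ffunP=> a /=.
by rewrite !ffunE; case: (f a) => //= b; rewrite ffunE.
Qed.

Fact IC_mulr1 : right_id IC_one IC_mul.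
Proof.
by move=> f; apply: val_inj; apply/ffunP=> a /=; rewrite !ffunE.
Qed.

HB.instance Definition _ := isMonoid.Build (IC n) IC_mulA IC_mul1 IC_mulr1.

End ICMonoid.

(* The vector space with basis (v_S), as the space of coordinate functions. *)
Definition Vspace (F : fieldType) (n : nat) := {ffun {set 'I_n} -> F^o}.

Section Module.

Variables (F : fieldType) (n : nat).
Local Notation V := (Vspace F n).
Implicit Types (f g : IC n) (S T : {set 'I_n}) (u v : V).

Definition basis_vec S : V := [ffun T => (T == S)%:R].

Lemma basis_vec_decomp u : u = \sum_S u S *: basis_vec S.
Proof.
apply/ffunP=> T; rewrite sum_ffunE (bigD1 T) //= !ffunE eqxx big1 => [|S neS].
  by rewrite addr0 [RHS]mulr1.
by rewrite !ffunE eq_sym (negPf neS) [LHS]mulr0.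
Qed.

Definition act_basis f S : V :=
  if S \subset pdom f then basis_vec (pimage f S) else 0.

Definition act f u : V := \sum_S u S *: act_basis f S.

Fact act_is_linear f : linear (act f).
Proof.
move=> c u v; rewrite /act scaler_sumr -big_split /=; apply: eq_bigr => S _.
by rewrite !ffunE scalerDl scalerA.
Qed.

HB.instance Definition _ f := GRing.isLinear.Build F V V _ (act f) (act_is_linear f).

Lemma act_basis_vec f S : act f (basis_vec S) = act_basis f S.
Proof.
rewrite /act (bigD1 S) //= ffunE eqxx scale1r big1 ?addr0 // => T neT.
by rewrite ffunE (negPf neT) scale0r.
Qed.

Lemma act1 u : act 1%g u = u.
Proof.
rewrite [RHS]basis_vec_decomp; apply: eq_bigr => S _.
by rewrite /act_basis pdom_id subsetT pimage_id.
Qed.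

Lemma actM f g u : act (f * g)%g u = act f (act g u).
Proof.
rewrite [act g u]/act linear_sum /=; apply: eq_bigr => S _.
rewrite linearZ /=; congr (_ *: _).
rewrite /act_basis pdom_comp pimage_comp; case: ifP => /= [/andP[-> sI]|].
  by rewrite act_basis_vec /act_basis sI.
by case: ifP => /= _ h; rewrite ?linear0 // act_basis_vec /act_basis h.
Qed.

Definition is_submodule (U : {vspace V}) : Prop :=
  forall f u, u \in U -> act f u \in U.

Definition gen_submodule v : {vspace V} := <<[seq act f v | f : IC n]>>%VS.

Lemma mem_gen_submodule v : v \in gen_submodule v.
Proof.
apply: memv_span; apply/imageP; exists (1%g : IC n) => //.
by rewrite act1.
Qed.

Lemma gen_submodule_is_submodule v : is_submodule (gen_submodule v).
Proof.
move=> f u uG; pose h := linfun (act f).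
suff sub : (h @: gen_submodule v <= gen_submodule v)%VS.
  have -> : act f u = h u by rewrite lfunE.
  exact: subvP sub _ (memv_img h uG).
rewrite /gen_submodule limg_span; apply/span_subvP=> w /mapP[x /imageP[g _ ->] ->].
rewrite lfunE /= -actM; apply: memv_span.
by apply/imageP; exists (f * g)%g.
Qed.

Lemma gen_submodule_min v (U : {vspace V}) :
  is_submodule U -> v \in U -> (gen_submodule v <= U)%VS.
Proof. by move=> sU vU; apply/span_subvP=> w /imageP[f _ ->]; apply: sU. Qed.

End Module.

(* binomz a b is the binomial coefficient with an integer lower entry; the
   upper entry only takes nonnegative values here. *)
Definition binomz (a : nat) (b : int) : int :=
  if b is Posz k then 'C(a, k)%:Z else 0.

(* The elements t_1 < ... < t_l of T; indices are 0-based. *)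
Definition elt_at n (T : {set 'I_n}) (i : 'I_#|T|) : nat := elt (enum_val i).

Lemma elt_at_increasing n (T : {set 'I_n}) (i j : 'I_#|T|) :
  (i < j)%N -> (elt_at i < elt_at j)%N.
Proof.
move=> lt_ij; have x0 : 'I_n := enum_val i.
rewrite /elt_at /elt ltnS !(enum_val_nth x0).
have srt : sorted ltn (map val (enum T)).
  rewrite -[enum _](eq_filter (mem_enum _)) -(eq_filter (mem_map val_inj _)).
  by rewrite -filter_map (sorted_filter ltn_trans) // -enumT val_enum_ord iota_ltn_sorted.
have lt_sz (k : 'I_#|T|) : (k < size (enum T))%N by rewrite -cardE.
rewrite -!(nth_map x0 0%N val) //.
by apply: (sorted_ltn_nth ltn_trans 0%N srt); rewrite ?inE ?size_map.
Qed.

Definition binom_mx n (T : {set 'I_n}) : 'M[int]_#|T| :=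
  \matrix_(i, j) binomz (elt_at i + 1) (j%:Z - i%:Z + 1).

(* Main.v *)
Require Import Defs.
From mathcomp Require Import all_boot all_order all_fingroup all_algebra.
From mathcomp Require Import zify.

Import GRing.Theory.
Local Open Scope ring_scope.

(** The images of [S] under the monoid are exactly the sets [T] of the same
    cardinality that lie componentwise below [S], so [d_S] counts these.  Let
    [D_lo s = det 'C(s_i + 1 - lo, j - i + 1)].  Column operations based on
    Pascal's rule give [D_lo (x :: s) = D_(lo+1) (x :: s) + D_lo s], and
    [D_(x+1) (x :: s) = 0].  Hence the alternating sum [A_lo s] of [D_lo] over
    the subsequences of [s] satisfies
    [A_lo (x :: s) = A_(lo+1) (x :: s) + A_(lo+1) s] for [lo < x] and
    [A_x (x :: s) = 0], which is the recurrence, according to whether [lo + 1]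
    is used, for the number of increasing sequences with entries above [lo]
    that are componentwise at most [s]. *)

(** * Determinants with shifted upper entries *)

Lemma binomzS (a : nat) (b : int) :
  binomz a.+1 b = binomz a b + binomz a (b - 1).
Proof.
case: b => [[|k]|k] //=; first by rewrite !bin0.
by rewrite subn1 /= binS PoszD.
Qed.

Definition shifted_binom_mx m lo (s : seq nat) : 'M[int]_m :=
  \matrix_(i, j) binomz (nth 0%N s i + 1 - lo) (j%:Z - i%:Z + 1).

Definition shifted_det lo s := \det (shifted_binom_mx (size s) lo s).

Definition elts {n} (T : {set 'I_n}) : seq nat := [seq elt i | i <- enum T].

Lemma det_binom_mx n (T : {set 'I_n}) :
  \det (binom_mx T) = shifted_det 0 (elts T).
Proof.
rewrite /shifted_det /elts size_map -cardE; congr (\det _).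
apply/matrixP=> i j; rewrite !mxE subn0; congr (binomz (_ + _) _).
have x0 : 'I_n := enum_val i.
by rewrite /elt_at (nth_map x0) -?cardE // (enum_val_nth x0).
Qed.

Lemma shifted_det_nil lo : shifted_det lo [::] = 1.
Proof. exact: det_mx00. Qed.

(* The shift by [x + 1] makes the first row vanish. *)
Lemma shifted_det_last x s : shifted_det x.+1 (x :: s) = 0.
Proof.
rewrite /shifted_det (expand_det_row _ ord0) big1 // => j _.
have e : j%:Z - (@ord0 (size s))%:Z + 1 = j.+1%:Z by rewrite subr0 -PoszD addn1.
by rewrite mxE e addn1 subnn /= bin0n mul0r.
Qed.

(* Pascal's rule makes every column of the matrix with shift [lo] the sum of
   two adjacent columns of the one with shift [lo + 1], except that the first
   column is increased by the first unit vector. *)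
Lemma shifted_det_cons lo x s : all (leq lo) (x :: s) ->
  shifted_det lo (x :: s) = shifted_det lo.+1 (x :: s) + shifted_det lo s.
Proof.
move=> /allP le_lo; rewrite /shifted_det /=.
set m := size s; set B := shifted_binom_mx _ lo _.
set A := shifted_binom_mx _ _ _.
(* Right multiplication by the unitriangular [U] adds to each column its left neighbour. *)
pose U : 'M[int]_m.+1 := \matrix_(k, j) ((k == j)%:R + (k.+1 == j :> nat)%:R).
have detU : \det U = 1.
  rewrite -det_tr det_trig.
    rewrite big1 // => i _; rewrite !mxE eqxx.
    by have -> : (i.+1 == i :> nat) = false by lia.
  apply/is_trig_mxP=> i j lt_ij; rewrite !mxE.
  have -> : (j == i) = false by apply/eqP=> e; move: lt_ij; rewrite e ltnn.
  by have -> : (j.+1 == i :> nat) = false by lia.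
have AU i j : (A *m U) i j = A i j + \sum_k A i k * (k.+1 == j :> nat)%:R.
  rewrite mxE; under eq_bigr do rewrite [U _ _]mxE mulrDr.
  rewrite big_split /= (bigD1 j) //= eqxx mulr1 big1 ?addr0 // => k.
  by move/negPf->; rewrite mulr0.
(* Column 0 has no left neighbour, so Pascal's rule leaves there the term [binomz a (- i)], which is
   1 for [i = 0] and 0 otherwise. The bound [lo <= s_i] keeps the truncated subtraction positive, so
   that the rule applies. *)
have BE i j : B i j = (A *m U) i j + ((i == ord0) && (j == ord0))%:R.
  have /le_lo ge_lo : nth 0%N (x :: s) i \in x :: s by rewrite mem_nth.
  rewrite AU !mxE (_ : _ + 1 - lo = (nth 0%N (x :: s) i + 1 - lo.+1).+1)%N;
    last by rewrite -/m; lia.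
  rewrite binomzS addrK -[RHS]addrA; congr (_ + _).
  case: (unliftP ord0 j) => [k|] ->.
    rewrite lift_eqF andbF addr0 lift0 (bigD1 (widen_ord (leqnSn m) k)) //= big1 ?addr0.
      by rewrite mxE eqxx mulr1 /=; congr (binomz _ _); lia.
    move=> l /eqP ne; rewrite eqSS (_ : (l == k :> nat) = false) ?mulr0 //.
    by apply/eqP=> e; apply: ne; apply: val_inj.
  rewrite big1 ?add0r => [|l _]; last by rewrite mulr0.
  rewrite eqxx andbT; case: (unliftP ord0 i) => [k|] -> //=.
  by rewrite bin0.
have cofBE i : cofactor B i ord0 = cofactor (A *m U) i ord0.
  congr (_ * \det _); apply/matrixP=> k l.
  by rewrite mxE mxE BE lift_eqF andbF addr0 !mxE.
rewrite (expand_det_col B ord0).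
under eq_bigr do rewrite BE eqxx andbT cofBE mulrDl.
rewrite big_split /= -expand_det_col det_mulmx detU mulr1; congr (_ + _).
(* The correction contributes only the minor of [B] without first row and column. Since [j - i] is
   unchanged by this deletion, it is the determinant for [s] with the same shift. *)
rewrite (bigD1 ord0) //= big1 ?addr0 => [|i /negPf ->]; last by rewrite mul0r.
rewrite mul1r -cofBE /cofactor expr0 mul1r; congr (\det _).
by apply/matrixP=> i j; rewrite !mxE !lift0 /=; congr (binomz _ _); lia.
Qed.

(** * Alternating sums over subsequences, as counts *)

Fixpoint subseqs {T} (s : seq T) : seq (seq T) :=
  if s is x :: s' then [seq x :: t | t <- subseqs s'] ++ subseqs s'
  else [:: [::]].

Lemma subseqs_map {T T'} (f : T -> T') s :
  subseqs [seq f x | x <- s] = [seq map f t | t <- subseqs s].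
Proof.
by elim: s => //= x s ->; rewrite map_cat -!map_comp; congr (_ ++ _).
Qed.

Lemma subseqs_subseq {T : eqType} {s t : seq T} :
  t \in subseqs s -> subseq t s.
Proof.
elim: s t => [|x s IHs] t; first by rewrite inE.
rewrite mem_cat => /orP[/mapP[u /IHs us ->] | /IHs ts]; first by rewrite /= eqxx.
exact: subseq_trans ts (subseq_cons _ _).
Qed.

Definition alt_sum lo s : int :=
  \sum_(t <- subseqs s) (-1) ^+ (size s - size t) * shifted_det lo t.

Lemma alt_sum_cons lo x s : alt_sum lo (x :: s) =
  \sum_(t <- subseqs s) (-1) ^+ (size s - size t) * shifted_det lo (x :: t)
    - alt_sum lo s.
Proof.
rewrite /alt_sum big_cat big_map /=; congr (_ + _).
rewrite -sumrN !big_seq; apply: eq_bigr => t /subseqs_subseq/size_subseq le_ts.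
by rewrite subSn // exprS mulN1r mulNr.
Qed.

(** The summands [shifted_det lo t] produced by [shifted_det_cons] cancel the contribution of the
    subsequences that omit [x]. *)
Lemma alt_sum_consS lo x s : all (leq lo) (x :: s) -> alt_sum lo (x :: s) =
  \sum_(t <- subseqs s) (-1) ^+ (size s - size t) * shifted_det lo.+1 (x :: t).
Proof.
move=> /= /andP[le_x /allP le_s]; rewrite alt_sum_cons -sumrB !big_seq.
apply: eq_bigr => t /subseqs_subseq/mem_subseq sub_ts.
rewrite shifted_det_cons ?mulrDr ?addrK //= le_x.
by apply/allP=> y /sub_ts/le_s.
Qed.

(** Induction on the number [m] of admissible values above [lo]. The case of an entry equal to [lo]
    is included because the recurrence raises [lo] while keeping [x]. *)
Lemma alt_sum_count m lo s : sorted ltn s -> all (leq lo) s ->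
  all (geq (lo + m)%N) s ->
  alt_sum lo s = \sum_(t <- subseqs (iota lo.+1 m)) (all2 leq t s)%:Z.
Proof.
have cnt0 u l : \sum_(t <- subseqs (iota u l)) (all2 leq t [::])%:Z = 1.
  elim: l u => [|l IHl] u /=; first by rewrite big_seq1.
  by rewrite big_cat IHl big_map big1.
elim: m lo s => [|m IHm] lo [|x s] srt lo_s s_hi; rewrite ?cnt0;
  try by rewrite /alt_sum big_seq1 shifted_det_nil.
  (* With [m = 0] the bounds force [x = lo]: the left side vanishes, and the only candidate, the
     empty sequence, is too short. *)
  have e : lo = x by move: lo_s s_hi => /= /andP[? _] /andP[? _]; lia.
  subst lo.
  by rewrite big_seq1 alt_sum_consS // big1 // => t _; rewrite shifted_det_last mulr0.
have [/= lo_x _] := andP lo_s; have [/= x_hi s_hi'] := andP s_hi.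
case: ltngtP lo_x => // [lt_lo_x|eq_lo_x] _.
  rewrite alt_sum_consS // big_cat big_map.
  have srt' := path_sorted srt.
  have lo_s' : all (leq lo.+1) s.
    by apply: sub_all (order_path_min ltn_trans srt) => y; apply: ltn_trans.
  rewrite -(IHm lo.+1 (x :: s)) /= ?addSnnS ?lt_lo_x ?x_hi // -(IHm lo.+1 s) ?addSnnS //.
  by rewrite alt_sum_cons addrC subrK.
(* For [lo = x] all entries of a candidate exceed [x], so none lies componentwise below [x :: s]. *)
subst lo; rewrite alt_sum_consS // big1 => [|t _]; last first.
  by rewrite shifted_det_last mulr0.
rewrite big_cat big_map big1 /= => [|t _]; last by rewrite ltnn.
rewrite add0r big_seq big1 // => -[|y t] //.
move=> /subseqs_subseq/mem_subseq/(_ y (mem_head _ _)).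
by rewrite mem_iota /= => /andP[lt_xy _]; rewrite leqNgt (ltnW lt_xy).
Qed.

(** * Subsets as increasing sequences *)

Lemma elt_inj {n} : injective (@elt n).
Proof. by move=> i j [/val_inj]. Qed.

Lemma elts_setT n : elts [set: 'I_n] = iota 1 n.
Proof.
rewrite /elts enum_setT -enumT (map_comp S val) val_enum_ord.
by rewrite (iotaDl 1 0).
Qed.

Lemma sorted_elts {n} (T : {set 'I_n}) : sorted ltn (elts T).
Proof.
have /(subseq_sorted ltn_trans) : subseq (elts T) (elts [set: 'I_n]).
  by apply: map_subseq; rewrite enum_setT; apply: filter_subseq.
by apply; rewrite elts_setT iota_ltn_sorted.
Qed.

Lemma enum_sorted n (s : seq 'I_n) :
  sorted ltn [seq elt i | i <- s] -> enum [set:: s] = s.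
Proof.
move=> srt; apply: (inj_map (elt_inj)).
apply: (irr_sorted_eq ltn_trans ltnn _ srt) => [|k]; first exact: sorted_elts.
by apply: eq_mem_map => i; rewrite mem_enum inE.
Qed.

(** Removing the head [x] matches the subsets that contain it with the subsets of the tail, and
    sortedness puts [x] first in their enumeration. *)
Lemma sum_subsets {R : nmodType} {n} {s : seq 'I_n} (G : seq 'I_n -> R) :
  sorted ltn [seq elt i | i <- s] ->
  \sum_(T : {set 'I_n} | T \subset [set:: s]) G (enum T) =
  \sum_(t <- subseqs s) G t.
Proof.
elim: s G => [|x s IHs] G srt /=.
  rewrite big_seq1 (big_pred1 set0) ?enum_set0 // => T.
  by rewrite set_nil subset0.
have x_lt : all (ltn (elt x)) [seq elt i | i <- s].
  exact: order_path_min ltn_trans srt.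
have srt' : sorted ltn [seq elt i | i <- s] := path_sorted srt.
set A := [set:: s] in IHs.
have xNA : x \notin A.
  by rewrite inE; apply/negP=> /(map_f (@elt n))/(allP x_lt) /=; rewrite ltnn.
rewrite set_cons big_cat big_map /= (bigID (fun T : {set 'I_n} => x \in T)) /=.
congr (_ + _); last first.
  rewrite -IHs //; apply: eq_bigl => T; apply/andP/idP=> [[sT xNT]|sT].
    by rewrite -(setU1K xNA) subsetD1 sT.
  by rewrite (subset_trans sT (subsetU1 _ _)); split=> //; apply: contra xNA; apply: subsetP.
rewrite -(IHs (fun t => G (x :: t))) //.
rewrite (reindex_onto (fun T => x |: T) (fun T => T :\ x)) /=; last first.
  by move=> T /andP[_ xT]; rewrite setD1K.
apply: eq_big => [T|T /andP[/andP[sT _] /eqP eT]].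
  rewrite setU11 andbT subUset sub1set setU11 /=.
  apply/andP/idP=> [[sT /eqP eT]|sT].
    by rewrite -(setU1K xNA) -eT setSD // subUset sub1set setU11.
  have xNT : x \notin T by apply: contra xNA; apply: subsetP.
  by rewrite setU1K // (subset_trans sT) ?subsetU1.
congr G; have sub_TA : T \subset A.
  by rewrite -(setU1K xNA) -eT setSD.
rewrite -[RHS]enum_sorted; first by rewrite set_cons set_enum.
rewrite /= path_sortedE; last exact: ltn_trans.
rewrite sorted_elts andbT; apply/allP=> _ /mapP[i iT ->]; apply: (allP x_lt).
by apply: map_f; move: iT; rewrite mem_enum => /(subsetP sub_TA); rewrite inE.
Qed.

Lemma sum_subsets_elts {R : nmodType} {n} (S : {set 'I_n}) (G : seq nat -> R) :
  \sum_(T : {set 'I_n} | T \subset S) G (elts T) =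
  \sum_(t <- subseqs (elts S)) G t.
Proof.
rewrite subseqs_map big_map -(sum_subsets (fun t => G [seq elt i | i <- t])).
  by rewrite set_enum.
exact: sorted_elts.
Qed.

(** * The dimension as a number of images *)

Lemma free_basis_vec F n (s : seq {set 'I_n}) :
  uniq s -> free [seq basis_vec F T | T <- s].
Proof.
elim: s => [|S s IHs] /=; first by rewrite nil_free.
move=> /andP[SNs /IHs fr]; rewrite free_cons fr andbT.
(* Evaluating a dependence at [S] would give 1 = 0. *)
apply/negP=> /(coord_span (X := in_tuple _)) /ffunP/(_ S).
rewrite ffunE eqxx sum_ffunE big1 => [/eqP|i _]; first by rewrite oner_eq0.
have lt_i : (i < size s)%N by rewrite -(size_map (@basis_vec F n) s).
rewrite ffunE (nth_map S) // ffunE eq_sym.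
rewrite (_ : (_ == S) = false) ?scaler0 //.
by apply: contraNF SNs => /eqP <-; apply: mem_nth.
Qed.

(** Each generator [act f (basis_vec F S)] is zero or a basis vector, so the distinct images index a
    basis. *)
Lemma dim_gen_submodule F n (S : {set 'I_n}) :
  \dim (gen_submodule (basis_vec F S)) =
  #|[set pimage f S | f : IC n & S \subset pdom f]|.
Proof.
set X := [set _ | _ in _].
have /eqP dimX := free_basis_vec F n (enum X) (enum_uniq X).
rewrite size_map -cardE in dimX; rewrite -dimX; congr (\dim _).
apply/eqP; rewrite eqEsubv; apply/andP; split; apply/span_subvP=> w.
  move=> /imageP[f _ ->]; rewrite act_basis_vec /act_basis.
  case: ifP => sS; last exact: mem0v.
  by apply: memv_span; apply: map_f; rewrite mem_enum; apply/imsetP; exists f; rewrite ?inE.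
move=> /mapP[T + ->]; rewrite mem_enum => /imsetP[f sS ->].
apply: memv_span; apply/imageP; exists f => //.
by rewrite act_basis_vec /act_basis; move: sS; rewrite inE => ->.
Qed.

(** Order preservation and injectivity make [f] strictly increasing on [S], so the mapped list is
    already sorted. *)
Lemma enum_pimage n (f : IC n) (S : {set 'I_n}) : S \subset pdom f ->
  enum (pimage f S) = [seq odflt a (f a) | a <- enum S].
Proof.
move=> /subsetP sS; have [fi fm _] := in_ICP (f : pmapping n) (valP f).
have fE a : a \in S -> f a = Some (odflt a (f a)).
  by move/sS; rewrite inE; case: (f a).
rewrite -[RHS]enum_sorted; last first.
  have := sorted_elts S; rewrite /elts !sorted_map.
  apply: (sub_in_sorted (P := [in S])) => [a b aS bS /= lt_ab|]; last first.
    by apply/allP=> a; rewrite mem_enum.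
  rewrite ltn_neqAle /elt ltnS (fm _ _ _ _ (fE a aS) (fE b bS)) ?andbT;
    last by rewrite -ltnS ltnW.
  apply/eqP=> -[/val_inj eg]; move: lt_ab.
  by rewrite (fi a b _ (fE a aS)) ?ltnn // eg; apply: fE.
apply: eq_enum => b; rewrite !inE.
apply/exists_inP/mapP=> [[a aS /eqP fa]|[a + ->]].
  by exists a; rewrite ?mem_enum // fa.
by rewrite mem_enum => aS; exists a => //; apply/eqP; apply: fE.
Qed.

Lemma mem_pimages n (S T : {set 'I_n}) :
  (T \in [set pimage f S | f : IC n & S \subset pdom f]) =
  all2 leq (elts T) (elts S).
Proof.
apply/imsetP/idP=> [[f + ->]|].
  rewrite inE /elts => sS; rewrite enum_pimage //.
  have [_ _ fd] := in_ICP (f : pmapping n) (valP f).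
  elim: (enum S) => //= a s ->; rewrite andbT /elt ltnS.
  by case fa: (f a) => [b|] //=; apply: fd.
rewrite all2E => /andP[]; rewrite !size_map => /eqP eq_sz le_TS.
(* The witness sends each element of [S] to the element of the same rank in [T]; equal cardinalities
   keep the default of [nth] out of reach. *)
pose f : pmapping n :=
  [ffun a => if a \in S then Some (nth a (enum T) (index a (enum S))) else None].
have fS a b : f a = Some b -> a \in S /\ b = nth a (enum T) (index a (enum S)).
  by rewrite ffunE; case: ifP => // aS [<-].
have idx_lt a : a \in S -> (index a (enum S) < size (enum T))%N.
  by move=> aS; rewrite eq_sz index_mem mem_enum.
have nthE x0 (U : {set 'I_n}) i : (i < size (enum U))%N ->
  elt (nth x0 (enum U) i) = nth 0%N (elts U) i.
  by move=> lt_i; rewrite (nth_map x0).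
have fIC : in_IC f.
  apply/in_ICP; split=> [a a' b|a a' b b'|a b].
  - move=> /fS[aS ->] /fS[a'S]; rewrite (set_nth_default a') ?idx_lt //.
    move=> /eqP; rewrite nth_uniq ?idx_lt ?enum_uniq // => /eqP.
    by move/(index_inj a); apply; rewrite mem_enum.
  - move=> /fS[aS ->] /fS[a'S ->] le_aa'.
    rewrite -ltnS -[X in (X <= _)%N]/(elt _) -[X in (_ <= X)%N]/(elt _) !nthE ?idx_lt //.
    apply: (sorted_leq_nth leq_trans leqnn) => //;
      rewrite ?inE ?size_map ?idx_lt //.
      exact: sub_sorted ltnW _ (sorted_elts T).
    (* A smaller rank for [a'] would give [a' < a]. *)
    rewrite leqNgt; apply/negP=> lt_idx.
    have := sorted_ltn_nth ltn_trans 0%N (sorted_elts S) _ _ _ _ lt_idx.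
    rewrite !inE !size_map !index_mem !mem_enum => /(_ a'S aS).
    rewrite -!(nthE a) ?index_mem ?mem_enum // !nth_index ?mem_enum //.
    by rewrite ltnS ltnNge le_aa'.
  - move=> /fS[aS ->].
    have /(all_nthP (0%N, 0%N))/(_ (index a (enum S))) := le_TS.
    rewrite size_zip !size_map eq_sz minnn index_mem mem_enum => /(_ aS).
    rewrite nth_zip ?size_map //= -!(nthE a) ?idx_lt ?index_mem ?mem_enum //.
    by rewrite nth_index ?mem_enum // ltnS.
have sS : S \subset pdom f by apply/subsetP=> a aS; rewrite inE ffunE aS.
exists (MkIC fIC); first by rewrite inE.
apply/setP=> b; rewrite inE /=; apply/idP/exists_inP=> [bT|[a aS /eqP/fS[_ ->]]].
  have lt_b : (index b (enum T) < size (enum S))%N.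
    by rewrite -eq_sz index_mem mem_enum.
  exists (nth b (enum S) (index b (enum T))); first by rewrite -mem_enum mem_nth.
  rewrite ffunE -mem_enum mem_nth // index_uniq ?enum_uniq //.
  by rewrite (set_nth_default b) ?nth_index ?index_mem ?mem_enum.
by rewrite -mem_enum mem_nth // idx_lt.
Qed.

Theorem theorem4p11 (F : fieldType) (charF0 : [pchar F] =i pred0) (n : nat)
    (S : {set 'I_n}) :
  (\dim (gen_submodule (basis_vec F S)))%:Z =
  \sum_(T : {set 'I_n} | T \subset S) (-1) ^+ #|S :\: T| * \det (binom_mx T).
Proof.
transitivity (alt_sum 0 (elts S)); last first.
  rewrite /alt_sum -sum_subsets_elts; apply: eq_bigr => T sTS.
  by rewrite det_binom_mx !size_map -!cardE cardsD (setIidPr sTS).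
rewrite (alt_sum_count n) ?sorted_elts //; last 2 first.
- exact/allP.
- by apply/allP=> _ /mapP[i _ ->]; apply: ltn_ord.
(* [iota 1 n] lists the full set, so the candidate sequences become subsets of it. *)
rewrite -elts_setT -(sum_subsets_elts _ (fun t => (all2 leq t (elts S))%:Z)).
rewrite dim_gen_submodule -sum1_card big_mkcond.
rewrite (big_morph Posz PoszD (erefl 0%:Z)); apply: eq_big => T.
  by rewrite subsetT.
by rewrite mem_pimages; case: all2.
Qed.
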